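(* Let $F$ be a field with a nontrivial valuation $v$ and valuation domain $O_v$. Let $R$ be a torsion-free algebra over $O_v$. Then $R$ satisfies GD (going down) over $O_v$; that is, for any $P_1\subset P_2$ in $\operatorname{Spec}(O_v)$ and every $Q_2\in\operatorname{Spec}(R)$ lying over $P_2$, there exists $Q_1\in\operatorname{Spec}(R)$ lying over $P_1$ with $Q_1\subset Q_2$.
   Context: $\subset$ means proper inclusion. $O_v=\{x\in F: v(x)\ge0\}$. Rings are associative with $1$, not necessarily commutative; $\operatorname{Spec}(R)$ is the set of prime (two-sided) ideals. An $O_v$-algebra is a ring $R$ with a unitary ring homomorphism $O_v\to Z(R)$, $c\mapsto c\cdot 1_R$; it is torsion-free if $cr=0$ with $c\in O_v$, $r\in R$ implies $c=0$ or $r=0$. An ideal $Q$ of $R$ is lying over $P\subseteq O_v$ if $P=\{c\in O_v: c\cdot 1_R\in Q\}$. *)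

(* Defs.v *)
From HB Require Import structures.
From mathcomp Require Import all_boot all_order all_algebra.
From mathcomp Require Import boolp classical_sets.

Set Implicit Arguments.
Unset Strict Implicit.
Unset Printing Implicit Defensive.

Import Order.TTheory GRing.Theory Num.Theory.
Local Open Scope classical_set_scope.
Local Open Scope ring_scope.

(* porderZmodType does not relate its order to its addition, hence the mixin. *)
HB.mixin Record POrderedZmodule_isOrderedGroup G of Num.POrderedZmodule G := {
  og_le_total : total (<=%R : rel G);
  og_leD2l : forall z x y : G, x <= y -> z + x <= z + y
}.

#[short(type="orderedGroupType")]
HB.structure Definition OrderedGroup :=
  {G of Num.POrderedZmodule G & POrderedZmodule_isOrderedGroup G}.

(* Gamma extended with an element infinity, represented by None. *)
Section ExtendedGroup.
Variable G : orderedGroupType.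
Implicit Types a b : option G.

Definition vadd a b : option G :=
  match a, b with Some x, Some y => Some (x + y) | _, _ => None end.

Definition vle a b : bool :=
  match a, b with
  | _, None => true
  | None, Some _ => false
  | Some x, Some y => x <= y
  end.

Definition vmin a b : option G := if vle a b then a else b.

End ExtendedGroup.

(* Valuations of arbitrary rank; the value group is the subgroup of G of
   finite values of v, surjectivity onto G is not required. *)
Record valuation (F : fieldType) (G : orderedGroupType) := Valuation {
  val_fun :> F -> option G;
  val_infty : forall x, val_fun x = None <-> x = 0;
  valM : forall x y, val_fun (x * y) = vadd (val_fun x) (val_fun y);
  valD : forall x y, vle (vmin (val_fun x) (val_fun y)) (val_fun (x + y))
}.

Definition nontrivial_val (F : fieldType) (G : orderedGroupType)
    (v : valuation F G) : Prop :=
  exists2 x : F, x != 0 & v x <> Some 0.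

Section ValuationRing.
Variables (F : fieldType) (G : orderedGroupType) (v : valuation F G).

Definition Ov_pred : pred F := fun x => vle (Some 0) (v x).

Lemma val0 : v 0 = None. Proof. exact/val_infty. Qed.

Lemma val1 : v 1 = Some 0.
Proof.
have := valM v 1 1; rewrite mulr1.
case E: (v 1) => [g|] /=; last by move/val_infty/eqP: E; rewrite oner_eq0.
by case=> /eqP; rewrite -subr_eq subrr => /eqP <-.
Qed.

Lemma valN1 : v (-1) = Some 0.
Proof.
have := valM v (-1) (-1); rewrite mulrNN mulr1 val1.
case: (v (-1)) => [g|] //= [] /esym g2; congr Some.
apply: le_anti; have [g0|g0] := orP (og_le_total 0 g);
  by have := og_leD2l g _ _ g0; rewrite addr0 g2 g0 => ->.
Qed.

Lemma vle_trans (a b c : option G) : vle a b -> vle b c -> vle a c.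
Proof. by case: a b c => [x|] [y|] [z|] //=; apply: le_trans. Qed.

Lemma Ov_subring : subring_closed Ov_pred.
Proof.
have M x y : Ov_pred x -> Ov_pred y -> Ov_pred (x * y).
  rewrite /Ov_pred valM; case: (v x) (v y) => [a|] [b|] //= a0 b0.
  by rewrite (le_trans a0) // -{1}[a]addr0 og_leD2l.
split=> [|x y|x y]; rewrite !unfold_in.
- by rewrite /Ov_pred val1 /=.
- move=> x0 y0; apply: vle_trans (valD v x (- y)).
  rewrite /vmin; case: ifP => // _.
  by rewrite -mulN1r; apply: M y0; rewrite /Ov_pred valN1 /=.
- exact: M.
Qed.

HB.instance Definition _ := GRing.isSubringClosed.Build F Ov_pred Ov_subring.

Record Ov := MkOv { Ov_val : F; Ov_valP : Ov_pred Ov_val }.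

HB.instance Definition _ := [isSub for Ov_val].
HB.instance Definition _ := [Choice of Ov by <:].
HB.instance Definition _ := [SubChoice_isSubComNzRing of Ov by <:].

End ValuationRing.

Section Ideals.
Variable R : pzRingType.
Implicit Types I J P : set R.

Record two_sided_ideal I : Prop := TwoSidedIdeal {
  ideal_0 : I 0;
  ideal_D : forall x y, I x -> I y -> I (x + y);
  ideal_Ml : forall r x, I x -> I (r * x);
  ideal_Mr : forall r x, I x -> I (x * r)
}.

Definition ideal_mul I J : set R :=
  [set x | exists2 s : seq (R * R),
     forall p, p \in s -> I p.1 /\ J p.2 & x = \sum_(p <- s) p.1 * p.2].

Record prime_ideal P : Prop := PrimeIdeal {
  prime_is_ideal : two_sided_ideal P;
  prime_proper : P <> setT;
  prime_mul : forall I J, two_sided_ideal I -> two_sided_ideal J ->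
    ideal_mul I J `<=` P -> I `<=` P \/ J `<=` P
}.

Definition Spec : set (set R) := [set P | prime_ideal P].

End Ideals.

Arguments Spec R : clear implicits.

(* A C-algebra is a ring R with a structure morphism phi : C -> R whose image
   is central; algType C is not used because it excludes the zero ring. *)
Section Algebras.
Variables (C : comPzRingType) (R : pzRingType) (phi : {rmorphism C -> R}).

Definition central_morphism : Prop := forall (c : C) (r : R), phi c * r = r * phi c.

Definition torsion_free : Prop :=
  forall (c : C) (r : R), phi c * r = 0 -> c = 0 \/ r = 0.

Definition lying_over (Q : set R) (P : set C) : Prop := P = [set c | Q (phi c)].

Definition going_down : Prop :=
  forall P1 P2 : set C, Spec C P1 -> Spec C P2 -> P1 `<` P2 ->
  forall Q2 : set R, Spec R Q2 -> lying_over Q2 P2 ->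
  exists Q1 : set R, [/\ Spec R Q1, lying_over Q1 P1 & Q1 `<` Q2].

End Algebras.

(* Main.v *)
Require Import Defs.
From mathcomp Require Import all_boot all_order all_algebra.
From mathcomp Require Import boolp classical_sets.

(** Given primes [P1] and [P2] of the valuation ring with [P1 `<` P2], and a
    prime [Q2] of [R] over [P2], consider the products [phi c * s] with [c]
    outside [P1] and [s] outside [Q2]. They form an m-system, the
    noncommutative substitute for a multiplicative set: [phi c] and [phi c']
    are central and [Q2] is prime, so that some [phi c * s * x * (phi c' * s')]
    is again such a product. An ideal that contains [phi P1] and is maximal
    among those that miss this m-system is prime ([m_system_prime]); it lies in
    [Q2] because every [s] outside [Q2] is in the m-system (take [c = 1]), and
    it lies over [P1] because every [phi c] with [c] outside [P1] is in the
    m-system (take [s = 1]).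

    Such an ideal exists as soon as the extension of [P1] to [R] misses the
    m-system, and this is where valuations and torsion-freeness enter. Elements
    of [Ov v] are comparable for divisibility ([Ov_dvd_total]), so every element
    of the extension is a single product [phi p * r] with [p] in [P1], and [p]
    is a multiple [c * d] of any [c] outside [P1]. If [phi c * s = phi p * r],
    cancelling [phi c] gives [s = phi d * r]; as [P1] is prime, [d] is in [P1],
    hence in [P2], and [s] is in [Q2]. *)

Set Implicit Arguments.
Unset Strict Implicit.
Unset Printing Implicit Defensive.

Import GRing.Theory.
Local Open Scope classical_set_scope.
Local Open Scope ring_scope.

(** * Prime ideals and m-systems *)

Section PrimeIdeals.
Variable R : pzRingType.
Implicit Types (I J P Q M : set R) (a b : R).

Lemma ideal_1_setT I : two_sided_ideal I -> I 1 -> I = setT.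
Proof.
move=> idI I1; apply/seteqP; split=> // x _.
by rewrite -[x]mulr1; apply: ideal_Ml.
Qed.

Lemma prime_not1 P : prime_ideal P -> ~ P 1.
Proof. by move=> [idP ntP _] /(ideal_1_setT idP). Qed.

Lemma ideal_sum I (s : seq (R * R)) : two_sided_ideal I ->
  (forall p, p \in s -> I (p.1 * p.2)) -> I (\sum_(p <- s) p.1 * p.2).
Proof.
move=> idI Is; rewrite big_seq; elim/big_ind: _ => //.
- exact: ideal_0.
- exact: ideal_D.
Qed.

(** If [a * x * b] is in [P] for all [x], then the annihilator [J] of [a R]
    modulo [P] contains [b], the annihilator [I] of [J] modulo [P] contains
    [a], and both are two-sided ideals. Working with annihilators avoids
    describing the ideals generated by [a] and [b]. *)
Lemma prime_sandwich P a b : prime_ideal P -> ~ P a -> ~ P b ->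
  exists x, ~ P (a * x * b).
Proof.
move=> [idP _ mulP] Pa Pb; apply/not_existsP => Pab.
have {}Pab x : P (a * x * b) by apply: contrapT; exact: Pab.
pose J := [set y | forall x, P (a * x * y)].
pose I := [set x | forall y, J y -> P (x * y)].
have idJ : two_sided_ideal J.
  split=> [x|y z Jy Jz x|r y Jy x|r y Jy x].
  - by rewrite mulr0; apply: ideal_0.
  - by rewrite mulrDr; apply: ideal_D.
  - by rewrite mulrA -(mulrA a); apply: Jy.
  - by rewrite mulrA; apply: ideal_Mr => //; apply: Jy.
have idI : two_sided_ideal I.
  split=> [y Jy|x z Ix Iz y Jy|r x Ix y Jy|r x Ix y Jy].
  - by rewrite mul0r; apply: ideal_0.
  - by rewrite mulrDl; apply: ideal_D => //; [apply: Ix|apply: Iz].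
  - by rewrite -mulrA; apply: ideal_Ml => //; apply: Ix.
  - by rewrite -mulrA; apply: Ix; apply: (ideal_Ml idJ).
have IJP : ideal_mul I J `<=` P.
  move=> _ [s sIJ ->]; apply: ideal_sum => // p /sIJ[Ip Jp].
  exact: Ip.
case: (mulP I J idI idJ IJP) => [IP|JP].
- by apply: Pa; apply: IP => y Jy; rewrite -[a]mulr1; apply: Jy.
- by apply: Pb; apply: JP.
Qed.

Definition m_system M : Prop :=
  forall a b, M a -> M b -> exists x, M (a * x * b).

Definition ideal_add I J : set R :=
  [set z | exists x y, [/\ I x, J y & z = x + y]].

Lemma ideal_addP I J : two_sided_ideal I -> two_sided_ideal J ->
  two_sided_ideal (ideal_add I J).
Proof.
move=> idI idJ; split.
- by exists 0, 0; split; [exact: ideal_0|exact: ideal_0|rewrite addr0].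
- move=> _ _ [x [y [Ix Jy ->]]] [x' [y' [Ix' Jy' ->]]].
  by exists (x + x'), (y + y'); split; [exact: ideal_D|exact: ideal_D|
    rewrite addrACA].
- move=> r _ [x [y [Ix Jy ->]]].
  by exists (r * x), (r * y); split; [exact: ideal_Ml|exact: ideal_Ml|
    rewrite mulrDr].
- move=> r _ [x [y [Ix Jy ->]]].
  by exists (x * r), (y * r); split; [exact: ideal_Mr|exact: ideal_Mr|
    rewrite mulrDl].
Qed.

Lemma ideal_add_subl I J : two_sided_ideal J -> I `<=` ideal_add I J.
Proof. by move=> idJ x Ix; exists x, 0; split=> //; [exact: ideal_0|rewrite addr0]. Qed.

Lemma ideal_add_subr I J : two_sided_ideal I -> J `<=` ideal_add I J.
Proof. by move=> idI y Jy; exists 0, y; split=> //; [exact: ideal_0|rewrite add0r]. Qed.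

Definition ideal_above_avoiding I M : set (set R) :=
  [set Q | [/\ two_sided_ideal Q, I `<=` Q & forall x, Q x -> ~ M x]].

Lemma maximal_avoiding_ideal I M :
  two_sided_ideal I -> (forall x, I x -> ~ M x) ->
  exists2 Q, ideal_above_avoiding I M Q &
    forall B, Q `<` B -> ~ ideal_above_avoiding I M B.
Proof.
move=> idI IM.
(* The union of the empty chain is set0, which is not an ideal; it is admitted
   here and discarded once a maximal element is found. *)
pose S := [set X | X = set0 \/ ideal_above_avoiding I M X].
have [C CS chC|A [SA maxA]] := @Zorn_bigcup R S.
  have good X x : C X -> X x -> ideal_above_avoiding I M X.
    by move=> CX Xx; case: (CS _ CX) => // X0; rewrite X0 in Xx.
  have [[X [CX [x Xx]]]|noX] := pselect (exists X, C X /\ X !=set0); last first.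
    left; apply/seteqP; split=> // x [X CX Xx].
    by case: noX; exists X; split=> //; exists x.
  right; have [idX IX XM] := good X x CX Xx; split.
  - split.
    + by exists X => //; apply: ideal_0.
    + move=> y z [Y CY Yy] [Z CZ Zz].
      have [idY _ _] := good Y y CY Yy; have [idZ _ _] := good Z z CZ Zz.
      case: (chC Y Z CY CZ) => sub.
      * by exists Z => //; apply: ideal_D => //; apply: sub.
      * by exists Y => //; apply: ideal_D => //; apply: sub.
    + move=> r y [Y CY Yy]; have [idY _ _] := good Y y CY Yy.
      by exists Y => //; apply: ideal_Ml.
    + move=> r y [Y CY Yy]; have [idY _ _] := good Y y CY Yy.
      by exists Y => //; apply: ideal_Mr.
  - by move=> y Iy; exists X => //; apply: IX.
  - by move=> y [Y CY Yy]; have [_ _] := good Y y CY Yy; apply.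
case: SA => [A0|gA]; last first.
  by exists A => // B AB gB; apply: (maxA B AB); right.
exfalso; apply: (maxA I); last by right; split.
by rewrite A0; split=> // /(_ 0 (ideal_0 idI)).
Qed.

(** For [Q] maximal, if ideals [A] and [B] are not in [Q] then [Q + A] and
    [Q + B] meet [M], say in [q + a] and [q' + b]. Some
    [(q + a) * x * (q' + b)] is in [M], hence outside [Q], and it equals
    [a * x * b] modulo [Q], so [A B] is not in [Q]. *)
Lemma m_system_prime I M : m_system M -> M 1 ->
  two_sided_ideal I -> (forall x, I x -> ~ M x) ->
  exists2 Q, prime_ideal Q & I `<=` Q /\ forall x, Q x -> ~ M x.
Proof.
move=> msM M1 idI IM.
have [Q [idQ IQ QM] maxQ] := maximal_avoiding_ideal idI IM.
exists Q => //; split=> //; first by move=> QT; apply: (QM 1) => //; rewrite QT.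
move=> A B idA idB ABQ.
have meet J : two_sided_ideal J -> ~ J `<=` Q -> exists2 z, ideal_add Q J z & M z.
  move=> idJ JQ; apply: contrapT => noz; apply: (maxQ (ideal_add Q J)).
    split; first exact: ideal_add_subl.
    by move=> sub; apply: JQ => y Jy; apply: sub; apply: ideal_add_subr.
  split; first exact: ideal_addP.
  - by move=> x /IQ; apply: ideal_add_subl.
  - by move=> z addz Mz; apply: noz; exists z.
apply: contrapT => /not_orP[/(meet A idA)[_ [q [a [Qq Aa ->]]] Mqa]].
move=> /(meet B idB)[_ [q' [b [Qq' Bb ->]]] Mqb].
have [x] := msM _ _ Mqa Mqb; apply: QM.
rewrite mulrDr; apply: (ideal_D idQ); first exact: (ideal_Ml idQ).
rewrite 2!mulrDl; apply: (ideal_D idQ).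
  by rewrite -mulrA; apply: (ideal_Mr idQ).
apply: ABQ; exists [:: (a * x, b)]; last by rewrite big_seq1.
by move=> p; rewrite inE => /eqP ->; split=> //; apply: ideal_Mr.
Qed.

End PrimeIdeals.

(** * Divisibility in a valuation ring *)

Section ValuationRings.
Variables (F : fieldType) (G : orderedGroupType) (v : valuation F G).

Lemma Ov_pred_inv (x : F) : x != 0 -> Ov_pred v x \/ Ov_pred v x^-1.
Proof.
move=> x0; have := Defs.valM v x x^-1; rewrite divff // Defs.val1 /Ov_pred.
case: (v x) (v x^-1) => [a|] [b|] //= [ab0].
case/orP: (og_le_total 0 a) => [a0|a0]; [by left|right].
by have := og_leD2l b _ _ a0; rewrite addr0 addrC -ab0.
Qed.

Lemma Ov_dvd_total (x y : Ov v) :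
  (exists d, x = y * d) \/ (exists d, y = x * d).
Proof.
have dvd (a b : Ov v) : val b != 0 -> Ov_pred v (val a / val b) ->
    exists d, a = b * d.
  move=> b0 ab; exists (MkOv ab); apply: val_inj.
  by rewrite rmorphM /= mulrC divfK.
have [x0|x0] := eqVneq (val x) 0.
  by left; exists 0; apply: val_inj; rewrite mulr0.
have [y0|y0] := eqVneq (val y) 0.
  by right; exists 0; apply: val_inj; rewrite mulr0.
have xy0 : val x / val y != 0 by rewrite mulf_neq0 ?invr_eq0.
case: (Ov_pred_inv xy0) => [xy|]; first by left; apply: dvd.
by rewrite invf_div => yx; right; apply: dvd.
Qed.

End ValuationRings.

(** * Going down *)

Section GoingDown.
Variables (F : fieldType) (G : orderedGroupType) (v : valuation F G).
Variables (R : pzRingType) (phi : {rmorphism Ov v -> R}).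
Hypothesis phi_central : central_morphism phi.

(** The extension of [P] to [R]; over a valuation ring single products already
    form an ideal, because one of two elements of [P] divides the other. *)
Definition extension (P : set (Ov v)) : set R :=
  [set x | exists p r, P p /\ x = phi p * r].

Lemma extension_ideal P : two_sided_ideal P -> two_sided_ideal (extension P).
Proof.
move=> idP; split.
- by exists 0, 0; split; [exact: ideal_0|rewrite mulr0].
- move=> _ _ [p [r [Pp ->]]] [p' [r' [Pp' ->]]].
  case: (Ov_dvd_total p p') => [[d pE]|[d pE]].
  + by exists p', (phi d * r + r'); split=> //; rewrite pE rmorphM mulrDr mulrA.
  + by exists p, (r + phi d * r'); split=> //; rewrite pE rmorphM mulrDr mulrA.
- move=> x _ [p [r [Pp ->]]]; exists p, (x * r); split=> //.
  by rewrite mulrA -phi_central mulrA.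
- by move=> x _ [p [r [Pp ->]]]; exists p, (r * x); rewrite mulrA.
Qed.

Definition outer_products (P : set (Ov v)) (Q : set R) : set R :=
  [set x | exists c s, [/\ ~ P c, ~ Q s & x = phi c * s]].

Lemma outer_products_m_system P Q : prime_ideal P -> prime_ideal Q ->
  m_system (outer_products P Q).
Proof.
move=> prP prQ _ _ [c [s [Pc Qs ->]]] [c' [s' [Pc' Qs' ->]]].
have [d Pcdc] := prime_sandwich prP Pc Pc'.
have [x Qsxs] := prime_sandwich prQ Qs Qs'.
exists (phi d * x), (c * d * c'), (s * x * s'); split=> //.
rewrite !rmorphM -!mulrA; congr (_ * _).
rewrite [LHS]mulrA -phi_central -[LHS]mulrA; congr (_ * _).
by rewrite !mulrA phi_central -(mulrA s (phi c')) phi_central !mulrA.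
Qed.

Lemma extension_avoids_outer_products P1 P2 Q2 : torsion_free phi ->
  prime_ideal P1 -> P1 `<=` P2 -> prime_ideal Q2 -> lying_over phi Q2 P2 ->
  forall x, extension P1 x -> ~ outer_products P1 Q2 x.
Proof.
move=> tf prP1 P12 prQ2 Q2P2 _ [p [r [Pp ->]]] [c [s [Pc Qs]]].
have idP1 := prime_is_ideal prP1.
case: (Ov_dvd_total p c) => [[d pE]|[d cE]]; last first.
  by case: Pc; rewrite cE; apply: ideal_Mr.
rewrite pE rmorphM -mulrA => /eqP; rewrite -subr_eq0 -mulrBr => /eqP /tf[c0|].
  by case: Pc; rewrite c0; apply: ideal_0.
move/eqP; rewrite subr_eq0 => /eqP sE; apply: Qs; rewrite -sE.
apply: ideal_Mr; first exact: prime_is_ideal.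
have Pd : P1 d.
  apply: contrapT => Pd; have [e] := prime_sandwich prP1 Pc Pd.
  by apply; rewrite mulrAC -pE; apply: ideal_Mr.
by have := P12 _ Pd; rewrite Q2P2.
Qed.

End GoingDown.

Theorem theorem3p2 (F : fieldType) (G : orderedGroupType) (v : valuation F G)
    (v_nontrivial : nontrivial_val v)
    (R : pzRingType) (phi : {rmorphism Ov v -> R})
    (phi_central : central_morphism phi)
    (R_torsion_free : torsion_free phi) :
  going_down phi.
Proof.
move=> P1 P2 prP1 _ [P12 P21] Q2 prQ2 Q2P2.
have idP1 := prime_is_ideal prP1.
have P1not1 := prime_not1 prP1; have Q2not1 := prime_not1 prQ2.
have [||Q1 prQ1 [extQ1 Q1avoid]] := @m_system_prime _ _ _ _ _
    (extension_ideal phi_central idP1)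
    (extension_avoids_outer_products R_torsion_free prP1 P12 prQ2 Q2P2).
- exact: outer_products_m_system.
- by exists 1, 1; rewrite rmorph1 mulr1.
have Q1P1 : lying_over phi Q1 P1.
  apply/seteqP; split=> c /=.
    by move=> P1c; apply: extQ1; exists c, 1; rewrite mulr1.
  move=> Q1c; apply: contrapT => P1c; apply: (Q1avoid _ Q1c).
  by exists c, 1; rewrite mulr1.
exists Q1; split=> //; split.
  move=> s Q1s; apply: contrapT => Q2s; apply: (Q1avoid _ Q1s).
  by exists 1, s; rewrite rmorph1 mul1r.
move=> Q21; apply: P21 => c; rewrite Q2P2 Q1P1; exact: Q21.
Qed.
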